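(* Let $(X,*,f)$ be an $f$-rack. Then $S_X$, the set of permutations defined by right multiplication $R_x$ ($x\in X$), forms an $f$-crossed set under the natural operation $R_x *_R R_y = R_{x*y}$ and the morphism $f_R(R_x) = R_{f(x)}$.
   Context: An $f$-shelf is a triple $(X,*,f)$ where $X$ is a set, $*$ is a binary operation on $X$ and $f:X\to X$ is a map such that $(x*y)*f(z) = (x*z)*(y*z)$ for all $x,y,z\in X$. An $f$-rack is an $f$-shelf such that for any $x,y\in X$ there exists a unique $z\in X$ with $z*y=f(x)$. An $f$-quandle is an $f$-rack such that $x*x=f(x)$ for all $x\in X$. An $f$-crossed set is an $f$-quandle $(X,*,f)$ such that, for any $x,y\in X$, $x*y=f(x)$ whenever $y*x=f(y)$. The right multiplication by $x\in X$ is the map $R_x:X\to X$, $R_x(u)=u*x$. The structure map of $S_X$ as an $f$-crossed set is $f_R$, i.e. the triple is $(S_X,*_R,f_R)$.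
   Formalization: The formal theorem assumes that every right multiplication R_x is a permutation of X; the f-rack axioms alone do not imply this when f is not onto, and without it R_x *_R R_y = R_{x*y} can fail to be well defined. *)

(* Defs.v *)
From mathcomp Require Import all_boot.

Set Implicit Arguments.
Unset Strict Implicit.
Unset Printing Implicit Defensive.

Section FShelves.

Variables (X : Type) (op : X -> X -> X) (f : X -> X).

Definition f_shelf : Prop :=
  forall x y z, op (op x y) (f z) = op (op x z) (op y z).

Definition f_rack : Prop :=
  f_shelf /\ forall x y, exists! z, op z y = f x.

Definition f_quandle : Prop :=
  f_rack /\ forall x, op x x = f x.

Definition f_crossed_set : Prop :=
  f_quandle /\ forall x y, op y x = f y -> op x y = f x.

End FShelves.

Section RightPermutations.

Variables (X : Type) (op : X -> X -> X).

Definition right_mul (x : X) : X -> X := fun u => op u x.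

(* S_X is a set of maps, not of indices: right multiplications that agree as
   maps are the same element. *)
Definition right_perms : Type :=
  {p : X -> X | bijective p /\ exists x, p = right_mul x}.

(* An f-rack may have right multiplications that are not bijective, since f
   need not be onto; so membership of R_x in S_X takes a proof. *)
Definition right_perm (Rbij : forall x, bijective (right_mul x)) (x : X) :
    right_perms :=
  exist _ (right_mul x) (conj (Rbij x) (ex_intro _ x erefl)).

End RightPermutations.

(* Main.v *)
(** Distributivity says R_(f z) R_y = R_(y * z) R_z. As every R_z is invertible,
    R_(y * z) = R_(f z) R_y R_z^-1. Taking y = z gives R_(z * z) = R_(f z), which
    is the quandle law. If R_z = R_z', then taking y = z against z' gives
    R_(f z') = R_(z * z') = R_(z * z) = R_(f z), so R_(f z), and with it
    R_(y * z), depends only on the permutations R_y and R_z. Finally both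
    R_(y * x) = R_(f y) and R_(x * y) = R_(f x) amount to
    R_(f x) R_y = R_(f y) R_x. *)
Require Import Defs.
From mathcomp Require Import all_boot.
From mathcomp Require Import boolp.

Set Implicit Arguments.
Unset Strict Implicit.
Unset Printing Implicit Defensive.

Section RightMultiplications.

Variables (X : Type) (op : X -> X -> X) (f : X -> X).
Hypotheses (shelfX : f_shelf op f)
  (Rbij : forall x : X, bijective (right_mul op x)).

Local Notation R := (right_mul op).

Lemma right_mulD y z : R (f z) \o R y = R (op y z) \o R z.
Proof. by apply: funext => x; apply: shelfX. Qed.

(** Only surjectivity of [R z] matters: a right inverse cancels it. *)
Lemma comp_right_mulI z (g h : X -> X) : g \o R z = h \o R z -> g = h.
Proof.
have [k _ Rk] := Rbij z => /(congr1 (fun F : X -> X => F \o k)) gh.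
by apply: funext => x; have /= := congr1 (fun F : X -> X => F x) gh; rewrite !Rk.
Qed.

Lemma right_mul_comp_inj z (g h : X -> X) : R z \o g = R z \o h -> g = h.
Proof.
move=> gh; apply: funext => x; apply: (bij_inj (Rbij z)).
exact: (congr1 (fun F : X -> X => F x) gh).
Qed.

Lemma right_mul_sqr x : R (op x x) = R (f x).
Proof. by apply: (@comp_right_mulI x); rewrite -right_mulD. Qed.

Lemma right_mul_f_eq z z' : R z = R z' -> R (f z) = R (f z').
Proof.
move=> zz'; have opzz' : op z z = op z z' := congr1 (fun F : X -> X => F z) zz'.
rewrite -right_mul_sqr opzz'; apply: (@comp_right_mulI z').
by rewrite -right_mulD zz'.
Qed.

Lemma right_mul_op_eq y y' z z' :
  R y = R y' -> R z = R z' -> R (op y z) = R (op y' z').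
Proof.
move=> yy' zz'; apply: (@comp_right_mulI z).
by rewrite -right_mulD zz' -right_mulD yy' (right_mul_f_eq zz').
Qed.

(** Serves uniqueness in the rack law: after composing with [R z], distributivity leaves the
    injective [R (f z)] on the left. *)
Lemma right_mul_op_inj y y' z : R (op y z) = R (op y' z) -> R y = R y'.
Proof.
by move=> e; apply: (@right_mul_comp_inj (f z)); rewrite !right_mulD e.
Qed.

Lemma right_mul_crossed x y : R (op y x) = R (f y) -> R (op x y) = R (f x).
Proof.
by move=> e; apply: (@comp_right_mulI y); rewrite -right_mulD -e -right_mulD.
Qed.

(** By proof irrelevance, the map determines the element. *)
Lemma eq_right_perm x y : R x = R y -> right_perm Rbij x = right_perm Rbij y.
Proof. by move=> e; apply: eq_exist. Qed.

Lemma right_perm_surj p : exists x, p = right_perm Rbij x.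
Proof. by case: p => p [pbij [x e]]; exists x; apply: eq_exist. Qed.

End RightMultiplications.

Theorem proposition2p14 (X : Type) (op : X -> X -> X) (f : X -> X)
    (hX : f_rack op f)
    (Rbij : forall x : X, bijective (right_mul op x)) :
  exists (opR : right_perms op -> right_perms op -> right_perms op)
         (fR : right_perms op -> right_perms op),
    [/\ forall x y : X,
          opR (right_perm Rbij x) (right_perm Rbij y) =
          right_perm Rbij (op x y),
        forall x : X, fR (right_perm Rbij x) = right_perm Rbij (f x)
      & f_crossed_set opR fR].
Proof.
have [shelfX rackX] := hX.
pose S := right_perm Rbij.
(* Choice picks an index for each permutation; the operations are computed on these indices. *)
pose idx p := sval (cid (right_perm_surj Rbij p)).
have idxK p : S (idx p) = p by rewrite /idx; case: cid.
have RS x y : S x = S y -> right_mul op x = right_mul op y.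
  by move=> /(congr1 sval).
pose opR p q := S (op (idx p) (idx q)); pose fR p := S (f (idx p)).
have opRE x y : opR (S x) (S y) = S (op x y).
  (* [idx (S x)] may differ from [x], but both give the same permutation. *)
  by apply: eq_right_perm; apply: (right_mul_op_eq shelfX Rbij); apply/RS/idxK.
have fRE x : fR (S x) = S (f x).
  by apply: eq_right_perm; apply: (right_mul_f_eq shelfX Rbij); apply/RS/idxK.
have elimS p : exists x, p = S x by exact: right_perm_surj.
exists opR, fR; split=> //; split; first split; first split.
- move=> p q r; have [[x ->] [y ->] [z ->]] := And3 (elimS p) (elimS q) (elimS r).
  by rewrite fRE !opRE shelfX.
- move=> p q; have [[x ->] [y ->]] := conj (elimS p) (elimS q).
  have [z [zy _]] := rackX x y.
  exists (S z); split=> [|r]; first by rewrite opRE fRE zy.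
  (* Uniqueness in [X] does not apply: [op w y] and [op z y] agree only as right multiplications. *)
  have [w ->] := elimS r; rewrite opRE fRE -zy => /RS wy.
  by apply/eq_right_perm/esym/(right_mul_op_inj shelfX Rbij wy).
- move=> p; have [x ->] := elimS p.
  by rewrite opRE fRE; apply/eq_right_perm/right_mul_sqr.
- move=> p q; have [[x ->] [y ->]] := conj (elimS p) (elimS q).
  rewrite !opRE !fRE => /RS yx.
  by apply/eq_right_perm/(right_mul_crossed shelfX Rbij yx).
Qed.
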